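(* Let $k\ge 1$ and let $f\in C^k(\mathcal X\times\mathcal U,\mathbb R^n)$ with $f(0,0)=0$, where $\mathcal X\times\mathcal U\subseteq\mathbb R^n\times\mathbb R^m$ is a neighborhood of the origin. The control system $\dot x=f(x,u)$ is locally exponentially stabilizable by means of a composition operator $T_h$ with a $C^k$ stationary symbol $h$ if and only if $f$ has a stationary $C^k$ local section near the origin.
   Context: $C^k$ denotes $k$-times continuously differentiable maps ($k=\infty$ allowed). For a neighborhood of the origin $\mathcal O\subseteq\mathcal X$ and a map $h:\mathcal O\to\mathcal X\times\mathcal U$, the composition operator $T_h$ with symbol $h$ is defined by $T_hf:=f\circ h$. The system $\dot x=f(x,u)$ is locally asymptotically (resp. exponentially) stabilizable by means of a composition operator $T_h$ if there are such an $\mathcal O$ and $h$ for which the origin is a locally asymptotically (resp. exponentially) stable equilibrium of $\dot x=T_hf(x)$. The symbol is stationary if $h(0)=(0,0)$. Standing assumption (uniqueness criterion): a stabilizing composition operator $T_h$ is always required to be such that $T_hf$ is continuous and $\dot x=T_hf(x)$ has a unique solution $x(t)$ for all $t\ge0$ and all initial states $x_0$ in a neighborhood of the origin. A local section of $f$ near the origin is a continuous map $\alpha:\mathcal O'\to\mathcal X\times\mathcal U$, with $\mathcal O'\subseteq\mathbb R^n$ an open neighborhood of $0$, such that $f(\alpha(y))=y$ for all $y\in\mathcal O'$. It is stationary if $\alpha(0)=(0,0)$, and a $C^k$ local section if $\alpha$ is $C^k$. *)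

(* Defs.v *)
From HB Require Import structures.
From mathcomp Require Import all_boot all_order all_algebra.
From mathcomp Require Import all_classical all_reals all_analysis.
Set Implicit Arguments.
Unset Strict Implicit.
Unset Printing Implicit Defensive.
Import Order.TTheory GRing.Theory Num.Theory.
Import numFieldNormedType.Exports.
Local Open Scope classical_set_scope.
Local Open Scope ring_scope.

(* A map defined on a set D is represented by a total function; no definition
   below depends on its values outside D. *)

Inductive smoothness := Fin of nat | Infty.

Definition at_least_C1 (k : smoothness) : Prop :=
  if k is Fin j then (1 <= j)%N else True.

(* In finite dimension, x |-> 'd F x is a C^j map into the space of linear maps
   iff x |-> 'd F x v is C^j for every vector v. *)
Fixpoint Cfin_open (R : realType) (V W : normedModType R) (j : nat)
    (D : set V) (F : V -> W) : Prop :=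
  match j with
  | 0 => forall x, D x -> {for x, continuous F}
  | j'.+1 => (forall x, D x -> differentiable F x) /\
             forall v : V, Cfin_open j' D (fun x => 'd F x v : W)
  end.

Definition C_open (R : realType) (V W : normedModType R) (k : smoothness)
    (D : set V) (F : V -> W) : Prop :=
  match k with
  | Fin j => Cfin_open j D F
  | Infty => forall j, Cfin_open j D F
  end.

(* A map on an arbitrary set A is C^k if it extends to a C^k map on an open
   superset of A; for A open this is the usual notion, see C_on_open. *)
Definition C_on (R : realType) (V W : normedModType R) (k : smoothness)
    (A : set V) (f : V -> W) : Prop :=
  exists D : set V, exists F : V -> W,
    [/\ open D, A `<=` D, (forall x, A x -> F x = f x) & C_open k D F].

Lemma Cfin_open_sub (R : realType) (V W : normedModType R) (j : nat)
    (A D : set V) (F : V -> W) :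
  A `<=` D -> Cfin_open j D F -> Cfin_open j A F.
Proof.
move=> AD; elim: j F => [|j IH] F /=; first by move=> h x /AD; exact: h.
by move=> [h1 h2]; split=> [x /AD|v]; [exact: h1|exact/IH/h2].
Qed.

Lemma near_eq_diff (R : realType) (V W : normedModType R) (f g : V -> W)
    (x : V) :
  (\forall y \near x, f y = g y) -> differentiable f x ->
  differentiable g x /\ 'd f x = 'd g x :> (V -> W).
Proof.
move=> fg df.
have key : g \o shift x = cst (g x) + 'd f x +o_ 0 id.
  apply/eqaddoP => _/posnumP[e].
  have /eqaddoP /(_ e%:num) /(_ [gt0 of e%:num]) := diff_locally df.
  have fg0 : \forall y \near 0, f (y + x) = g (y + x).
    by move: fg; rewrite (near_shift 0) subr0.
  apply: filter_app2 fg0 => /=; near=> y => E.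
  rewrite -![(_ + _ : _ -> _) _]/(_ + _) -![(- _ : _ -> _) _]/(- _) /=.
  by rewrite /cst /= E (nbhs_singleton fg).
have E : 'd g x = 'd f x :> (V -> W).
  by apply: diff_unique => //; exact: diff_continuous.
by split=> //; apply/diff_locallyP; rewrite E; split => //; exact: diff_continuous.
Unshelve. all: by end_near. Qed.

Lemma Cfin_open_ext (R : realType) (V W : normedModType R) (j : nat)
    (D : set V) (F G : V -> W) :
  open D -> (forall x, D x -> F x = G x) -> Cfin_open j D F -> Cfin_open j D G.
Proof.
move=> oD; elim: j F G => [|j IH] F G FG /=.
  move=> cF x Dx; rewrite /prop_for /continuous_at -(FG x Dx).
  apply: cvg_trans (cF x Dx); apply: near_eq_cvg.
  by apply: filterS (open_nbhs_nbhs (conj oD Dx)) => y /FG.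
have nFG x : D x -> \forall y \near x, F y = G y.
  by move=> Dx; apply: filterS (open_nbhs_nbhs (conj oD Dx)) => y /FG.
move=> [dF cF]; split=> [x Dx|v]; first by case: (near_eq_diff (nFG x Dx) (dF x Dx)).
apply: IH (cF v) => x Dx.
by case: (near_eq_diff (nFG x Dx) (dF x Dx)) => _ ->.
Qed.

Lemma C_on_open (R : realType) (V W : normedModType R) (k : smoothness)
    (A : set V) (f : V -> W) :
  open A -> C_on k A f <-> C_open k A f.
Proof.
move=> oA; split=> [[D [F [oD AD Ff]]]|cf]; last by exists A, f; split.
case: k => [j|] cF; last first.
  by move=> j; apply: (Cfin_open_ext oA Ff); exact: Cfin_open_sub (cF j).
by apply: (Cfin_open_ext oA Ff); exact: Cfin_open_sub cF.
Qed.

Definition comp_op (A B C : Type) (h : A -> B) (f : B -> C) : A -> C := f \o h.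

(* x solves x' = g(x) on the interval J, of the form [0, T[ or [0, +oo[,
   without leaving the domain O of g. For continuous g, continuity of x at 0
   makes the one-sided derivative of x at 0 equal to g (x 0). *)
Definition is_solution (R : realType) (n : nat) (O : set 'rV[R]_n)
    (g : 'rV[R]_n -> 'rV[R]_n) (J : set R) (x : R -> 'rV[R]_n) : Prop :=
  [/\ forall t, J t -> O (x t),
      {within J, continuous x} &
      forall t, J t -> 0 < t -> is_derive t (1 : R) x (g (x t))].

(* Uniqueness is required among all forward solutions, including those only
   defined on a bounded interval. *)
Definition uniqueness_criterion (R : realType) (n : nat) (O : set 'rV[R]_n)
    (g : 'rV[R]_n -> 'rV[R]_n) : Prop :=
  {within O, continuous g} /\
  \forall x0 \near (0 : 'rV[R]_n),
    exists x : R -> 'rV[R]_n,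
      [/\ is_solution O g `[0, +oo[ x, x 0 = x0 &
          forall (T : R) (y : R -> 'rV[R]_n), 0 < T ->
            is_solution O g `[0, T[ y -> y 0 = x0 ->
            forall t, 0 <= t < T -> y t = x t].

Definition exp_stable_equilibrium (R : realType) (n : nat) (O : set 'rV[R]_n)
    (g : 'rV[R]_n -> 'rV[R]_n) : Prop :=
  g 0 = 0 /\
  exists delta M lambda : R,
    [/\ 0 < delta, 0 < M, 0 < lambda &
        forall x : R -> 'rV[R]_n, is_solution O g `[0, +oo[ x ->
          `|x 0| < delta ->
          forall t, 0 <= t -> `|x t| <= M * expR (- (lambda * t)) * `|x 0|].

Definition exp_stabilizing (R : realType) (n m : nat)
    (X : set 'rV[R]_n) (U : set 'rV[R]_m)
    (f : 'rV[R]_n * 'rV[R]_m -> 'rV[R]_n)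
    (O : set 'rV[R]_n) (h : 'rV[R]_n -> 'rV[R]_n * 'rV[R]_m) : Prop :=
  [/\ nbhs (0 : 'rV[R]_n) O, O `<=` X, (forall x, O x -> (X `*` U) (h x)),
      uniqueness_criterion O (comp_op h f) &
      exp_stable_equilibrium O (comp_op h f)].

Definition stationary (R : realType) (n m : nat)
    (h : 'rV[R]_n -> 'rV[R]_n * 'rV[R]_m) : Prop := h 0 = (0, 0).

Definition exp_stabilizable_C_stationary (R : realType) (n m : nat)
    (k : smoothness) (X : set 'rV[R]_n) (U : set 'rV[R]_m)
    (f : 'rV[R]_n * 'rV[R]_m -> 'rV[R]_n) : Prop :=
  exists (O : set 'rV[R]_n) (h : 'rV[R]_n -> 'rV[R]_n * 'rV[R]_m),
    [/\ exp_stabilizing X U f O h, C_on k O h & stationary h].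

Definition local_section (R : realType) (n m : nat)
    (X : set 'rV[R]_n) (U : set 'rV[R]_m)
    (f : 'rV[R]_n * 'rV[R]_m -> 'rV[R]_n)
    (O' : set 'rV[R]_n) (alpha : 'rV[R]_n -> 'rV[R]_n * 'rV[R]_m) : Prop :=
  [/\ open O' /\ O' 0, {within O', continuous alpha},
      (forall y, O' y -> (X `*` U) (alpha y)) &
      forall y, O' y -> f (alpha y) = y].

Definition has_C_stationary_section (R : realType) (n m : nat)
    (k : smoothness) (X : set 'rV[R]_n) (U : set 'rV[R]_m)
    (f : 'rV[R]_n * 'rV[R]_m -> 'rV[R]_n) : Prop :=
  exists (O' : set 'rV[R]_n) (alpha : 'rV[R]_n -> 'rV[R]_n * 'rV[R]_m),
    [/\ local_section X U f O' alpha, C_on k O' alpha & stationary alpha].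

(* Main.v *)
Require Import Defs.
From HB Require Import structures.
From mathcomp Require Import all_boot all_order all_algebra.
From mathcomp Require Import all_classical all_reals all_analysis.
From mathcomp Require Import ring lra.
Import Order.TTheory GRing.Theory Num.Theory.
Import numFieldNormedType.Exports.
Local Open Scope classical_set_scope.
Local Open Scope ring_scope.

(** If [alpha] is a section, then the symbol [h x := alpha (- x)] closes the
    loop to [x' = - x], whose solutions [expR (- t) *: x0] are unique and decay
    exponentially (lemma [stabilizer_of_section]).

    Conversely, let [h] be a stabilizing symbol and [g := f \o h]. A section is
    [h \o phi] for any local right inverse [phi] of [g], so that by the inverse
    function theorem it suffices that the Jacobian of [g] at the origin be
    invertible (lemma [section_of_stabilizer]). A singular Jacobian is
    incompatible with exponential stability (lemma [exp_stable_jacobian_unit]):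
    there would be a nonzero linear form [l] that kills the linear part of [g],
    and [l] could change along small solutions only at a rate [o(|x|)], too slow
    for the prescribed decay.

    The inverse function theorem (theorem [inverse_function]) comes from
    Banach's fixed point theorem, for a map made close to the identity by
    inverting its differential at the base point. The smoothness of the local
    inverse follows by induction on the degree from the formula for its
    differential, Cramer's formula, and the stability of [C^j] maps under sums,
    products, quotients and compositions. *)

Set Implicit Arguments.
Unset Strict Implicit.
Unset Printing Implicit Defensive.

(** * Calculus of maps of class C^j *)

Section Calculus.
Context {R : realType}.

(** The Leibniz rule, read off from the differential of the continuous bilinear
    map [(k, w) |-> k *: w]. *)
Lemma is_diff_scale (V W : normedModType R) (a da : V -> R) (F dF : V -> W)
    (x : V) :
  is_diff x a da -> is_diff x F dF ->
  is_diff x (fun y => a y *: F y) (fun v => a x *: dF v + da v *: F x).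
Proof.
move=> ada FdF.
have bil : bilinear_for (GRing.Scale.Law.clone _ _ *:%R _)
    (GRing.Scale.Law.clone _ _ *:%R _) ( *:%R : R -> W -> W).
  split=> [u'|u] b y z /=; first by rewrite scalerDl scalerA.
  by rewrite scalerDr !scalerA mulrC.
pose bM := bilinear_isBilinear.Build R R W W _ _ ( *:%R : R -> W -> W) bil.
pose b : {bilinear R -> W -> W} := HB.pack ( *:%R : R -> W -> W) bM.
have bc : continuous (fun p : R * W => b p.1 p.2) by exact: scale_continuous.
have bd : is_diff (a x, F x) (fun p : R * W => p.1 *: p.2)
    (fun q => a x *: q.2 + q.1 *: F x).
  apply: DiffDef; first exact: (@differentiable_bilin _ _ _ _ b).
  exact: (@diff_bilin _ _ _ _ b).
exact: (@is_diff_comp _ _ _ _ (fun y => (a y, F y)) _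
          (fun p : R * W => p.1 *: p.2) _ x).
Qed.

Lemma is_diff_linear (V W : normedModType R) (L : {linear V -> W}) (x : V) :
  continuous L -> is_diff x L L.
Proof.
by move=> cL; apply: DiffDef; [exact: linear_differentiable|exact: diff_lin].
Qed.

(** The differential of [F] is usually known through a formula [F'] that holds on
    [D] only; since [D] is open, smoothness can be tested on the formula. *)
Lemma Cfin_openS_intro (V W : normedModType R) (j : nat) (D : set V)
    (F : V -> W) (F' : V -> V -> W) :
  open D -> (forall x, D x -> is_diff x F (F' x)) ->
  (forall v, Cfin_open j D (fun x => F' x v)) -> Cfin_open j.+1 D F.
Proof.
move=> oD dF cF; split=> [x Dx|v]; first by case: (dF x Dx).
apply: Cfin_open_ext oD _ (cF v) => x Dx.
by have /= -> := @diff_val _ _ _ _ _ _ _ (dF x Dx).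
Qed.

Lemma Cfin_open_diff (V W : normedModType R) (j : nat) (D : set V)
    (F : V -> W) (x : V) : Cfin_open j.+1 D F -> D x -> is_diff x F ('d F x).
Proof. by move=> [dF _] Dx; exact/differentiableP/dF. Qed.

Lemma Cfin_openW (V W : normedModType R) (j : nat) (D : set V) (F : V -> W) :
  Cfin_open j.+1 D F -> Cfin_open j D F.
Proof.
elim: j F => [|j IH] F [dF cF]; last by split=> // v; exact: IH.
by move=> x Dx; exact/differentiable_continuous/dF.
Qed.

Lemma Cfin_open_continuous (V W : normedModType R) (j : nat) (D : set V)
    (F : V -> W) : Cfin_open j D F -> forall x, D x -> {for x, continuous F}.
Proof. by elim: j F => // j IH F /Cfin_openW; exact: IH. Qed.

Lemma Cfin_open_cst (V W : normedModType R) (j : nat) (D : set V) (w : W) :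
  open D -> Cfin_open j D (fun _ : V => w).
Proof.
move=> oD; elim: j w => [|j IH] w; first by move=> x _; exact: cvg_cst.
by apply: (Cfin_openS_intro (F' := fun _ _ => 0)) => // x _; exact: is_diff_cst.
Qed.

Lemma Cfin_open_linear (V W : normedModType R) (j : nat) (D : set V)
    (L : {linear V -> W}) : open D -> continuous L -> Cfin_open j D L.
Proof.
move=> oD cL; case: j => [|j]; first by move=> x _; exact: cL.
apply: (Cfin_openS_intro (F' := fun _ => L)) => // [x _|v]; last first.
  exact: Cfin_open_cst.
exact: is_diff_linear.
Qed.

Lemma Cfin_open_postlinear (V W Z : normedModType R) (j : nat) (D : set V)
    (F : V -> W) (L : {linear W -> Z}) :
  open D -> continuous L -> Cfin_open j D F -> Cfin_open j D (fun x => L (F x)).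
Proof.
move=> oD cL; elim: j F => [|j IH] F cF.
  by move=> x Dx; apply: continuous_comp; [exact: cF|exact: cL].
apply: (Cfin_openS_intro (F' := fun x v => L ('d F x v))) => // [x Dx|v].
  have dF := Cfin_open_diff cF Dx.
  exact: (is_diff_comp dF (is_diff_linear (F x) cL)).
by apply: IH; exact: cF.2.
Qed.

Lemma Cfin_openD (V W : normedModType R) (j : nat) (D : set V)
    (F G : V -> W) :
  open D -> Cfin_open j D F -> Cfin_open j D G ->
  Cfin_open j D (fun x => F x + G x).
Proof.
move=> oD; elim: j F G => [|j IH] F G cF cG.
  by move=> x Dx; apply: cvgD; [exact: cF|exact: cG].
apply: (Cfin_openS_intro (F' := fun x v => 'd F x v + 'd G x v)) => // [x Dx|v].
  exact: (is_diffD (Cfin_open_diff cF Dx) (Cfin_open_diff cG Dx)).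
by apply: IH; [exact: cF.2|exact: cG.2].
Qed.

Lemma Cfin_open_sum (V W : normedModType R) (j : nat) (D : set V) (I : Type)
    (r : seq I) (P : pred I) (F : I -> V -> W) :
  open D -> (forall i, Cfin_open j D (F i)) ->
  Cfin_open j D (fun x => \sum_(i <- r | P i) F i x).
Proof.
move=> oD cF; elim: r => [|i r IH].
  by under eq_fun do rewrite big_nil; exact: Cfin_open_cst.
under eq_fun do rewrite big_cons.
by case: (P i) => //; apply: Cfin_openD.
Qed.

Lemma Cfin_openZ (V W : normedModType R) (j : nat) (D : set V)
    (a : V -> R) (F : V -> W) :
  open D -> Cfin_open j D a -> Cfin_open j D F ->
  Cfin_open j D (fun x => a x *: F x).
Proof.
move=> oD; elim: j a F => [|j IH] a F ca cF.
  by move=> x Dx; apply: cvgZ; [exact: ca|exact: cF].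
apply: (Cfin_openS_intro
  (F' := fun x v => a x *: 'd F x v + 'd a x v *: F x)) => // [x Dx|v].
  exact: (is_diff_scale (Cfin_open_diff ca Dx) (Cfin_open_diff cF Dx)).
apply: Cfin_openD => //; apply: IH.
- exact: Cfin_openW.
- exact: cF.2.
- exact: ca.2.
- exact: Cfin_openW.
Qed.

Lemma Cfin_open_prod (V : normedModType R) (j : nat) (D : set V) (I : Type)
    (r : seq I) (F : I -> V -> R) :
  open D -> (forall i, Cfin_open j D (F i)) ->
  Cfin_open j D (fun x => \prod_(i <- r) F i x).
Proof.
move=> oD cF; elim: r => [|i r IH].
  by under eq_fun do rewrite big_nil; exact: Cfin_open_cst.
by under eq_fun do rewrite big_cons; exact: Cfin_openZ.
Qed.

Lemma Cfin_openV (V : normedModType R) (j : nat) (D : set V) (a : V -> R) :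
  open D -> (forall x, D x -> a x != 0) ->
  Cfin_open j D a -> Cfin_open j D (fun x => (a x)^-1).
Proof.
move=> oD a0; elim: j => [|j IH] ca.
  by move=> x Dx; apply: cvgV; [exact: a0|exact: ca].
have cV := IH (Cfin_openW ca).
apply: (Cfin_openS_intro
  (F' := fun x v => ((-1 * (a x)^-1) * (a x)^-1) * 'd a x v)) => // [x Dx|v].
  have da := ca.1 x Dx.
  apply: DiffDef; first by apply: differentiableV => //; exact: a0.
  rewrite diffV//; last exact: a0.
  by apply/funext => v /=; rewrite mulN1r mulNr -expr2 exprVn.
apply: Cfin_openZ => //; last exact: ca.2.
by do 2!apply: Cfin_openZ => //; exact: Cfin_open_cst.
Qed.

(** A finite spanning family [e] with continuous coordinate forms [c].
    Smoothness is phrased through [x |-> 'd F x v] for each fixed [v]; a frame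
    expands a vector [v] that itself depends on [x] into finitely many fixed
    ones. *)
Definition frame (I : finType) (W : normedModType R) (c : I -> {linear W -> R})
    (e : I -> W) : Prop :=
  (forall i, continuous (c i)) /\ forall w, w = \sum_i c i w *: e i.

(** By the chain rule the differential of [G \o F] applied to [v] is
    [\sum_i c_i ('d F x v) *: 'd G (F x) (e_i)]; each [x |-> 'd G (F x) (e_i)]
    is again a composition, with an outer map that is one degree less smooth. *)
Lemma Cfin_open_comp (I : finType) (V W Z : normedModType R)
    (c : I -> {linear W -> R}) (e : I -> W) (j : nat) (D : set V) (E : set W)
    (F : V -> W) (G : W -> Z) :
  frame c e -> open D -> (forall x, D x -> E (F x)) ->
  Cfin_open j D F -> Cfin_open j E G -> Cfin_open j D (G \o F).
Proof.
move=> [cc ce] oD DE; elim: j Z G => [|j IH] Z G cF cG.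
  by move=> x Dx; apply: continuous_comp; [exact: cF|exact/cG/DE].
apply: (Cfin_openS_intro (F' := fun x v =>
    \sum_i c i ('d F x v) *: ((fun y => 'd G y (e i) : Z) \o F) x))
  => // [x Dx|v].
  have := is_diff_comp (Cfin_open_diff cF Dx) (Cfin_open_diff cG (DE x Dx)).
  congr (is_diff _ _ _); apply/funext => v /=.
  rewrite [in LHS](ce ('d F x v)) linear_sum; apply: eq_bigr => i _.
  by rewrite linearZ.
apply: Cfin_open_sum => // i; apply: Cfin_openZ => //.
  by apply: Cfin_open_postlinear => //; exact: cF.2.
by apply: IH; [exact: Cfin_openW|exact: cG.2].
Qed.

Lemma coord_is_linear m n (i : 'I_m) (k : 'I_n) :
  linear (fun M : 'M[R]_(m, n) => M i k : R).
Proof. by move=> a x y; rewrite !mxE. Qed.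

Definition coord_lin m n (i : 'I_m) (k : 'I_n) : {linear 'M[R]_(m, n) -> R} :=
  HB.pack (fun M : 'M[R]_(m, n) => M i k : R)
   (GRing.isLinear.Build _ _ _ _ _ (@coord_is_linear m n i k)).

Lemma coord_lin_continuous m n (i : 'I_m) (k : 'I_n) :
  continuous (coord_lin i k).
Proof. exact: coord_continuous. Qed.

Lemma rV_frame n :
  frame (coord_lin ord0) (fun k : 'I_n => delta_mx 0 k : 'rV[R]_n).
Proof.
by split=> [k|w]; [exact: coord_lin_continuous|exact: row_sum_delta].
Qed.

(** The product of the state and input spaces is the intermediate space of the
    composition [f \o h]. *)
Lemma pair_frame n m (VW := ('rV[R]_n * 'rV[R]_m)%type) :
  exists (c : 'I_n + 'I_m -> {linear VW -> R}) (e : 'I_n + 'I_m -> VW),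
    frame c e.
Proof.
have l1 (k : 'I_n) : linear (fun p : VW => p.1 ord0 k : R).
  by move=> a x y; rewrite !mxE.
have l2 (k : 'I_m) : linear (fun p : VW => p.2 ord0 k : R).
  by move=> a x y; rewrite !mxE.
pose c (s : 'I_n + 'I_m) : {linear VW -> R} :=
  match s with
  | inl k => HB.pack (fun p : VW => p.1 ord0 k : R)
     (GRing.isLinear.Build _ _ _ _ _ (l1 k))
  | inr k => HB.pack (fun p : VW => p.2 ord0 k : R)
     (GRing.isLinear.Build _ _ _ _ _ (l2 k))
  end.
exists c, (fun s => match s with
  | inl k => (delta_mx 0 k, 0) | inr k => (0, delta_mx 0 k) end).
split=> [[k|k] p|[x y]].
- by apply: (@continuous_comp _ _ _ fst (fun M : 'rV_n => M ord0 k));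
   [exact: cvg_fst|exact: coord_continuous].
- by apply: (@continuous_comp _ _ _ snd (fun M : 'rV_m => M ord0 k));
   [exact: cvg_snd|exact: coord_continuous].
rewrite big_sumType /=.

apply: injective_projections; rewrite raddfD !raddf_sum/=.
  under [X in _ + X]eq_bigr do rewrite scaler0.
  by rewrite big1_eq addr0 [LHS]row_sum_delta.
under eq_bigr do rewrite scaler0.
by rewrite big1_eq add0r [LHS]row_sum_delta.
Qed.

Lemma Cfin_open_coord (V : normedModType R) n (j : nat) (D : set V)
    (F : V -> 'rV[R]_n) :
  open D -> (forall i, Cfin_open j D (fun x => F x ord0 i : R)) ->
  Cfin_open j D F.
Proof.
move=> oD cF; have -> : F = fun x => \sum_i F x ord0 i *: delta_mx 0 i.
  by apply/funext => x; exact: row_sum_delta.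
by apply: Cfin_open_sum => // i; apply: Cfin_openZ => //; exact: Cfin_open_cst.
Qed.

Lemma Cfin_open_det (V : normedModType R) n (j : nat) (D : set V)
    (M : V -> 'M[R]_n) :
  open D -> (forall i k, Cfin_open j D (fun x => M x i k : R)) ->
  Cfin_open j D (fun x => \det (M x) : R).
Proof.
move=> oD cM; apply: Cfin_open_sum => // s.
by apply: Cfin_openZ => //; [exact: Cfin_open_cst|exact: Cfin_open_prod].
Qed.

(** Cramer's formula: the entries of the inverse are quotients of polynomials
    in the entries of the matrix. *)
Lemma Cfin_open_invmx (V : normedModType R) n (j : nat) (D : set V)
    (M : V -> 'M[R]_n) :
  open D -> (forall x, D x -> M x \in unitmx) ->
  (forall i k, Cfin_open j D (fun x => M x i k : R)) ->
  forall i k, Cfin_open j D (fun x => invmx (M x) i k : R).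
Proof.
move=> oD uM cM i k.
apply: (@Cfin_open_ext _ _ _ _ _
  (fun x => (\det (M x))^-1 *: cofactor (M x) k i)) => // [x Dx|].
  by rewrite /invmx uM// !mxE.
apply: Cfin_openZ => //.
  apply: Cfin_openV => //; last exact: Cfin_open_det.
  by move=> x Dx; rewrite -unitfE -unitmxE uM.
apply: Cfin_openZ => //; first exact: Cfin_open_cst.
by apply: Cfin_open_det => // i' k'; under eq_fun do rewrite !mxE.
Qed.

Lemma C_open_sub (V W : normedModType R) (k : smoothness) (A D : set V)
    (F : V -> W) : A `<=` D -> C_open k D F -> C_open k A F.
Proof.
move=> AD; case: k => [j|] cF => [|j]; first exact: Cfin_open_sub AD cF.
exact: Cfin_open_sub AD (cF j).
Qed.

Lemma C_open_C1 (V W : normedModType R) (k : smoothness) (D : set V)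
    (F : V -> W) :
  at_least_C1 k -> C_open k D F -> Cfin_open 1 D F.
Proof.
case: k => [j|_]; last exact.
elim: j => // -[|j] IH // _ cF; apply: IH => //.
exact: (@Cfin_openW V W j.+1 D F cF).
Qed.

Lemma C_open_comp (I : finType) (V W Z : normedModType R)
    (c : I -> {linear W -> R}) (e : I -> W) (k : smoothness) (D : set V)
    (E : set W) (F : V -> W) (G : W -> Z) :
  frame c e -> open D -> (forall x, D x -> E (F x)) ->
  C_open k D F -> C_open k E G -> C_open k D (G \o F).
Proof.
move=> ce oD DE; case: k => [j|] cF cG => [|j].
  exact: Cfin_open_comp ce oD DE cF cG.
exact: Cfin_open_comp ce oD DE (cF j) (cG j).
Qed.

End Calculus.

(** * Mean value inequalities *)

Section MeanValue.
Context {R : realType}.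

Lemma ler_coord_norm n (w : 'rV[R]_n) i : `|w ord0 i| <= `|w|.
Proof.
by rewrite [leRHS]/Num.Def.normr /= mx_normrE; exact: (le_bigmax _ _ (ord0, i)).
Qed.

Lemma rV_norm_le n (w : 'rV[R]_n) (c : R) :
  0 <= c -> (forall i, `|w ord0 i| <= c) -> `|w| <= c.
Proof.
move=> c0 wc; rewrite [leLHS]/Num.Def.normr /= mx_normrE.
by rewrite bigmax_le// => -[i k] _ /=; rewrite ord1.
Qed.

(** Turns statements about curves into statements about differentials, to which
    the chain rule and the Leibniz rule apply. *)
Lemma is_derive_is_diff (W : normedModType R) (F : R -> W) (t : R) (w : W) :
  is_derive t (1 : R) F w <-> is_diff t F (fun s => s *: w).
Proof.
split=> [dF|dF].
  have ddF : derivable F t 1 by case: dF.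
  apply: DiffDef; first exact/derivable1_diffP.
  by rewrite deriv1E// derive1E; case: dF => _ ->.
have ddF : differentiable F t by case: dF.
apply: DeriveDef; first exact/derivable1_diffP.
by rewrite deriveE//; case: dF => _ ->; rewrite scale1r.
Qed.

Lemma is_derive_linear (V W : normedModType R) (L : {linear V -> W})
    (x : R -> V) (t : R) (dx : V) :
  continuous L -> is_derive t (1 : R) x dx ->
  is_derive t (1 : R) (L \o x) (L dx).
Proof.
move=> cL /is_derive_is_diff dxt; apply/is_derive_is_diff.
have := is_diff_comp dxt (is_diff_linear (x t) cL).
by congr (is_diff _ _ _); apply/funext => s /=; rewrite linearZ.
Qed.

(** The norm on row vectors is the maximum of the coordinates, so the scalar
    mean value theorem, applied to one coordinate at a time, gives the sharp
    bound. *)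
Lemma mean_value_rV n (F F' : R -> 'rV[R]_n) (a b c : R) :
  a <= b -> (forall t, t \in `]a, b[%R -> is_derive t (1 : R) F (F' t)) ->
  {within `[a, b], continuous F} ->
  (forall t, t \in `]a, b[%R -> `|F' t| <= c) ->
  `|F b - F a| <= c * (b - a).
Proof.
rewrite le_eqVlt => /predU1P[-> _ _ _|ab dF cF Fc].
  by rewrite !subrr normr0 mulr0.
have c0 : 0 <= c.
  have mab : (a + b) / 2 \in `]a, b[%R by rewrite in_itv/= !midf_lt.
  exact: le_trans (normr_ge0 _) (Fc _ mab).
apply: rV_norm_le => [|i]; first by rewrite mulr_ge0// subr_ge0 ltW.
have dFi t : t \in `]a, b[%R ->
    is_derive t (1 : R) (fun s => F s ord0 i : R) (F' t ord0 i).
  move=> /dF dFt; have cL := @coord_lin_continuous R 1 n ord0 i.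
  exact: (is_derive_linear cL dFt).
have [|t tab] := MVT ab dFi.
  apply: (@within_continuous_comp _ _ _ _ F (fun M : 'rV_n => M ord0 i)) cF.
  by move=> M _; exact: coord_continuous.
rewrite !mxE => ->; rewrite normrM [`|b - a|]ger0_norm ?subr_ge0 ?(ltW ab)//.
by rewrite ler_wpM2r ?subr_ge0 ?(ltW ab)// (le_trans (ler_coord_norm _ _))// Fc.
Qed.

(** Balls are convex: the mean value inequality along the segment from [y] to
    [x], which stays in the ball. *)
Lemma ball_lipschitz (V : normedModType R) n (F : V -> 'rV[R]_n) (a : V)
    (r c : R) :
  (forall z, `|z - a| <= r -> differentiable F z) ->
  (forall z v, `|z - a| <= r -> `|'d F z v| <= c * `|v|) ->
  forall x y, `|x - a| <= r -> `|y - a| <= r ->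
  `|F x - F y| <= c * `|x - y|.
Proof.
move=> dF Fc x y xr yr; pose l (t : R) := t *: (x - y) + y.
have lr t : 0 <= t <= 1 -> `|l t - a| <= r.
  move=> /andP[t0 t1].
  have -> : l t - a = t *: (x - a) + (1 - t) *: (y - a).
    rewrite /l scalerBl scale1r addrCA -scalerBr opprB addrA subrK.
    by rewrite -addrA addrC.
  rewrite (le_trans (ler_normD _ _))// !normrZ !ger0_norm ?subr_ge0//.
  have -> : r = t * r + (1 - t) * r by rewrite -mulrDl addrC subrK mul1r.
  by rewrite lerD// ler_wpM2l// subr_ge0.
have dl (t : R) : is_diff t l (fun s => s *: (x - y)).
  have := is_diffD (is_diff_scalel t (x - y)) (is_diff_cst y t).
  by congr (is_diff _ _ _); apply/funext => s /=; rewrite fctE addr0.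
have dFl (t : R) : 0 <= t <= 1 -> is_derive t 1 (F \o l) ('d F (l t) (x - y)).
  move=> /lr /dF /differentiableP dFt; apply/is_derive_is_diff.
  have := is_diff_comp (dl t) dFt.
  by congr (is_diff _ _ _); apply/funext => s /=; rewrite linearZ.
have := @mean_value_rV n (F \o l) (fun t => 'd F (l t) (x - y)) 0 1
  (c * `|x - y|) ler01.
rewrite /= /l scale1r scale0r add0r subrK subr0 mulr1; apply.
- move=> t; rewrite in_itv/= => /andP[/ltW t0 /ltW t1].
  by apply: dFl; rewrite t0.
- apply: derivable_within_continuous => t; rewrite in_itv/= => t01.
  by have [] := dFl t t01.
- move=> t; rewrite in_itv/= => /andP[/ltW t0 /ltW t1].
  by apply/Fc/lr; rewrite t0.
Qed.

End MeanValue.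

(** * The inverse function theorem *)

(* Joins completeness with the norm, so that Banach's theorem applies to row
   vectors. *)
HB.instance Definition _ (R : realType) (m n : nat) :=
  Uniform_isComplete.Build 'M[R]_(m, n) (@cauchy_cvg 'M[R]_(m, n)).

Section InverseFunction.
Context {R : realType}.

Lemma linear_rV_continuous n (W : normedModType R)
    (L : {linear 'rV[R]_n -> W}) : continuous L.
Proof.
have -> : L = (fun v => \sum_k coord_lin ord0 k v *: L (delta_mx 0 k))
    :> (_ -> _).
  apply/funext => v; rewrite {1}(row_sum_delta v) linear_sum.
  by apply: eq_bigr => k _; rewrite linearZ.
move=> v; apply: (@Cfin_open_sum _ _ _ 0 setT) (I) => // [|k].
  exact: openT.
apply: (@Cfin_openZ _ _ _ 0 setT); first exact: openT.
  by apply: Cfin_open_linear; [exact: openT|exact: coord_lin_continuous].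
by apply: Cfin_open_cst; exact: openT.
Qed.

Lemma diffE_near (V W : normedModType R) (F : V -> W) (x : V) :
  differentiable F x -> forall e : R, 0 < e ->
  \forall h \near (0 : V), `|F (h + x) - F x - 'd F x h| <= e * `|h|.
Proof.
move=> dF _/posnumP[e].
have /eqaddoP /(_ e%:num) /(_ [gt0 of e%:num]) := diff_locally dF.
apply: filterS => h.
rewrite -![(_ + _ : _ -> _) _]/(_ + _) -![(- _ : _ -> _) _]/(- _) /=.
by rewrite opprD addrA.
Qed.

Lemma is_diff_near (V W : normedModType R) (F : V -> W) (x : V)
    (L : {linear V -> W}) :
  continuous L ->
  (forall e : R, 0 < e ->
    \forall h \near (0 : V), `|F (h + x) - F x - L h| <= e * `|h|) ->
  is_diff x F L.
Proof.
move=> cL FL.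
have key : F \o shift x = cst (F x) + L +o_ 0 id.
  apply/eqaddoP => e e0; apply: filterS (FL e e0) => h.
  rewrite -![(_ + _ : _ -> _) _]/(_ + _) -![(- _ : _ -> _) _]/(- _) /=.
  by rewrite opprD addrA.
have E : 'd F x = L :> (V -> W) by exact: diff_unique.
by apply: DiffDef => //; apply/diff_locallyP; rewrite E; split.
Qed.

(** Smoothness controls ['d F x v] for each [v] separately; in finite dimension
    the basis vectors suffice, which makes the estimate uniform in [v]. *)
Lemma diff_near_C1 n (W : normedModType R) (D : set 'rV[R]_n)
    (F : 'rV[R]_n -> W) (a : 'rV[R]_n) (e : R) :
  Cfin_open 1 D F -> D a -> 0 < e ->
  \forall x \near a, forall v, `|'d F x v - 'd F a v| <= e * `|v|.
Proof.
move=> [_ cF] Da e0.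
have d0 : 0 < e / n.+1%:R by rewrite divr_gt0.
have : \forall x \near a, forall k : 'I_n,
    `|'d F x (delta_mx 0 k) - 'd F a (delta_mx 0 k)| <= e / n.+1%:R.
  apply: (@filter_forall _ 'I_n (fun k x =>
    `|'d F x (delta_mx 0 k) - 'd F a (delta_mx 0 k)| <= e / n.+1%:R)
    (nbhs a)) => k.
  near=> x; rewrite distrC; near: x.
  have /cvgrPdist_le := cF (delta_mx 0 k) a Da; exact.
apply: filterS => x Fx v.
have dE y : 'd F y v = \sum_k v ord0 k *: 'd F y (delta_mx 0 k).
  rewrite {1}(row_sum_delta v) linear_sum.
  by apply: eq_bigr => k _; rewrite linearZ.
have -> : 'd F x v - 'd F a v = \sum_(k < n) v ord0 k *:
    ('d F x (delta_mx 0 k) - 'd F a (delta_mx 0 k)).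
  under eq_bigr do rewrite scalerBr.
  by rewrite sumrB; congr (_ - _); exact: dE.
apply: le_trans (ler_norm_sum _ _ _) _.
have : \sum_(k < n) `|v ord0 k *: ('d F x (delta_mx 0 k)
     - 'd F a (delta_mx 0 k))| <= \sum_(k < n) `|v| * (e / n.+1%:R).
  apply: ler_sum => k _; rewrite normrZ.
  by rewrite ler_pM//; exact: ler_coord_norm.
move=> /le_trans; apply.
rewrite sumr_const card_ord -[leLHS]mulr_natr [leRHS]mulrC -mulrA ler_wpM2l//.
by rewrite mulrAC ler_pdivrMr// ler_wpM2l ?(ltW e0)// ler_nat.
Unshelve. all: by end_near. Qed.

Lemma diffE_jacobian n m (F : 'rV[R]_n -> 'rV[R]_m) x v :
  'd F x v = v *m 'J F x.
Proof. by rewrite mul_rV_lin1. Qed.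

Lemma jacobian_unit n (F : 'rV[R]_n -> 'rV[R]_n) x :
  (forall v, 'd F x v = 0 -> v = 0) -> 'J F x \in unitmx.
Proof.
move=> inj; rewrite -row_free_unit; apply: inj_row_free => v.
by rewrite -diffE_jacobian; exact: inj.
Qed.

Lemma subrACA (V : zmodType) (a b c d : V) :
  (a - b) - (c - d) = (a - c) - (b - d).
Proof. by rewrite opprD addrACA -opprD. Qed.

(** The triangle inequality: [x - y] differs from [K x - K y] by a vector at most
    half as long as [x - y] itself. *)
Lemma perturbed_identity_inj (V : normedModType R) (K : V -> V) (x y : V) :
  `|(K x - x) - (K y - y)| <= 2^-1 * `|x - y| -> `|x - y| <= 2 * `|K x - K y|.
Proof.
move=> h; have : `|x - y| <= `|K x - K y| + 2^-1 * `|x - y|.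
  apply: le_trans (lerD (lexx _) h).
  have {1}-> : x - y = (K x - K y) - ((K x - x) - (K y - y)).
    by rewrite [K x - x - _]subrACA subKr.
  exact: ler_normB.
by rewrite mulrC; lra.
Qed.

(** The solutions of [K x = y] are the fixed points of [x |-> x - (K x - y)],
    which is a contraction of the closed ball into itself: it moves the centre
    by at most [r / 2], and it shrinks the ball by a factor of 2. *)
Lemma perturbed_identity_onto (V : completeNormedModType R) (K : V -> V)
    (a y : V) (r : R) :
  (forall x x', `|x - a| <= r -> `|x' - a| <= r ->
     `|(K x - x) - (K x' - x')| <= 2^-1 * `|x - x'|) ->
  `|y - K a| <= r / 2 -> exists2 x, `|x - a| <= r & K x = y.
Proof.
move=> Kr yr; have r0 : 0 <= r.
  by have := le_trans (normr_ge0 _) yr; rewrite pmulr_lge0.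
pose U : set V := [set x | `|x - a| <= r].
pose T x := x - (K x - y).
have TE x x' : T x - T x' = - ((K x - x) - (K x' - x')).
  rewrite /T subrACA [K x - y - _]subrACA subrr subr0.
  by rewrite [K x - x - _]subrACA [RHS]opprB.
have Ua : U a by rewrite /U /= subrr normr0.
have TU : set_fun U U T.
  move=> x Ux; rewrite /U /=.
  have -> : T x - a = (T x - T a) + (y - K a).
    by rewrite -[y - K a]opprB -[RHS]addrA -opprD subrK.
  rewrite (le_trans (ler_normD _ _))// TE normrN [leRHS]splitr lerD//.
  by rewrite (le_trans (Kr _ _ Ux Ua))// mulrC ler_pM2r ?invr_gt0.
pose Tf : {fun U >-> U} := HB.pack T (isFun.Build _ _ U U T TU).
have ctr : is_contraction Tf.
  exists (2^-1)%:nng; split => /=; first by lra.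
  by move=> [x x'] [/= Ux Ux']; rewrite TE normrN Kr.
have cU : closed U.
  have -> : U = closed_ball_ Num.Def.normr a r.
    by apply/funext => x; rewrite /U /closed_ball_ /= distrC.
  exact: closed_closed_ball_.
have [|x Ux xT] := banach_fixed_point ctr cU; first by exists a.
exists x => //; apply/subr0_eq.
have {}xT : x = x - (K x - y) by exact: xT.
by rewrite -[LHS](subKr x) -xT subrr.
Qed.

(** [K], the map [G] followed by the inverse of its differential at [a], has
    differential the identity at [a], so that by continuity [K - id] is
    [1/2]-Lipschitz on a small ball. *)
Lemma local_inverse n (D : set 'rV[R]_n) (G : 'rV[R]_n -> 'rV[R]_n)
    (a : 'rV[R]_n) :
  open D -> D a -> Cfin_open 1 D G -> (forall v, 'd G a v = 0 -> v = 0) ->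
  exists (E : set 'rV[R]_n) (phi : 'rV[R]_n -> 'rV[R]_n) (l : R),
    [/\ open E /\ E (G a), phi (G a) = a,
        forall y, E y ->
          [/\ D (phi y), G (phi y) = y & 'J G (phi y) \in unitmx] &
        forall y z, E y -> E z -> `|phi y - phi z| <= l * `|y - z|].
Proof.
move=> oD Da cG inj; have uJ := jacobian_unit inj.
set B := invmx ('J G a).
have [b b0 Bb] := linear_lipschitz (@linear_rV_continuous n _ (mulmxr B)).
pose K x := G x *m B.
have dK x : D x -> is_diff x K (fun v => 'd G x v *m B).
  move=> Dx; have dG := Cfin_open_diff cG Dx.
  have := @is_diff_linear R _ _ (mulmxr B) (G x) (@linear_rV_continuous _ _ _).
  exact: is_diff_comp.
have [r r0 rP] : exists2 r : R, 0 < r & forall x, `|x - a| <= r ->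
    D x /\ forall v, `|'d G x v *m B - v| <= 2^-1 * `|v|.
  have e0 : 0 < 2^-1 / b by rewrite divr_gt0// invr_gt0.
  have : \forall x \near a, D x /\
     forall v, `|'d G x v - 'd G a v| <= 2^-1 / b * `|v|.
    apply: filterI; first exact: open_nbhs_nbhs.
    exact: diff_near_C1 cG Da e0.
  move=> /nbhs_closedballP[r rP]; exists r%:num => // x xr.
  have [|Dx xG] := rP x.
    by rewrite closed_ballE// /closed_ball_ /= distrC.
  split=> // v.
  have -> : 'd G x v *m B - v = mulmxr B ('d G x v - 'd G a v).
    by rewrite /= mulmxBl [in X in _ = _ - X]diffE_jacobian mulmxK.
  rewrite (le_trans (Bb _))//; have := xG v.
  by rewrite mulrAC ler_pdivlMr// mulrC.
have inj' x : `|x - a| <= r -> forall v, 'd G x v = 0 -> v = 0.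
  move=> /rP[_ xG] v v0; have := xG v.
  rewrite v0 mul0mx sub0r normrN => h; apply/eqP; rewrite -normr_le0.
  by move: h; lra.
have Kr x x' : `|x - a| <= r -> `|x' - a| <= r ->
     `|(K x - x) - (K x' - x')| <= 2^-1 * `|x - x'|.
  have dKid z : `|z - a| <= r ->
      is_diff z (fun x => K x - x) (fun v => 'd G z v *m B - v).
    by move=> /rP[Dz _]; exact: (is_diffB (dK z Dz) (is_diff_id z)).
  apply: (@ball_lipschitz _ _ _ (fun x => K x - x)) => [z|z v] zr.
    by case: (dKid z zr).
  case: (dKid z zr) => _ ->; exact: (rP z zr).2.
pose E := [set y | `|y *m B - K a| < r / 2].
have phiE y : {x | E y -> `|x - a| <= r /\ K x = y *m B}.
  apply: cid; have [Ey|Ey] := pselect (E y); last by exists 0.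
  have [x xr xK] := perturbed_identity_onto Kr (ltW Ey).
  by exists x.
pose phi y := sval (phiE y).
have phiP y : E y -> `|phi y - a| <= r /\ K (phi y) = y *m B.
  exact: (svalP (phiE y)).
have lip y z : E y -> E z -> `|phi y - phi z| <= 2 * b * `|y - z|.
  move=> /phiP[yr yK] /phiP[zr zK].
  have := perturbed_identity_inj (Kr _ _ yr zr).
  move=> /le_trans; apply; rewrite -mulrA ler_wpM2l// yK zK -mulmxBl.
  exact: Bb.
have EGa : E (G a) by rewrite /E /= subrr normr0 divr_gt0.
have phiGa : phi (G a) = a.
  have [yr yK] := phiP _ EGa; apply/subr0_eq/normr0_eq0/eqP.
  have := perturbed_identity_inj (Kr _ a yr _).
  rewrite subrr normr0 yK subrr normr0 mulr0 eq_le normr_ge0 andbT.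
  by apply; exact: ltW.
have oE : open E.
  have -> : E = mulmxr B @^-1` ball (K a) (r / 2).
    by apply/funext => y; rewrite /E /= -ball_normE /= distrC.
  apply: open_comp; last exact: ball_open.
  by move=> y _; exact: linear_rV_continuous.
exists E, phi, (2 * b); split; [by []|by []| |exact: lip].
move=> y /phiP[yr yK]; split; first by have [] := rP _ yr.
  exact: (can_inj (mulmxKV uJ)).
by apply: jacobian_unit; exact: inj'.
Qed.

(** With [x = phi y], [x' = phi (h + y)] and [M] the Jacobian of [G] at [x], the
    remainder [x' - x - h M^-1] is [- (h - (x' - x) M) M^-1], that is, up to
    [M^-1], the first order remainder of [G] at [x]; it is [o(x' - x)], hence
    [o(h)] because [phi] is Lipschitz. *)
Lemma is_diff_inverse n (G phi : 'rV[R]_n -> 'rV[R]_n) (E : set 'rV[R]_n)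
    (l : R) (y : 'rV[R]_n) :
  open E -> E y -> differentiable G (phi y) -> 'J G (phi y) \in unitmx ->
  (forall z, E z -> G (phi z) = z) ->
  (forall z, E z -> `|phi z - phi y| <= l * `|z - y|) ->
  is_diff y phi (fun v => v *m invmx ('J G (phi y))).
Proof.
move=> oE Ey dG uJ Gphi lip; set M := 'J G (phi y).
have [b b0 Mb] :=
  linear_lipschitz (@linear_rV_continuous n _ (mulmxr (invmx M))).
apply: (@is_diff_near _ _ phi y (mulmxr (invmx M))).
  exact: linear_rV_continuous.
move=> e e0.
(* A positive Lipschitz constant, to divide by. *)
pose l' := Num.max l 1.
have l'0 : 0 < l' by rewrite lt_max ltr01 orbT.
have lip' z : E z -> `|phi z - phi y| <= l' * `|z - y|.
  by move=> /lip /le_trans; apply; rewrite ler_wpM2r// le_max lexx.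
have d0 : 0 < e / (b * l') by rewrite divr_gt0// mulr_gt0.
have near0 : \forall h \near (0 : 'rV[R]_n), E (h + y).
  have : \forall z \near y, E z by exact: open_nbhs_nbhs.
  by rewrite (near_shift 0) subr0.
have cphi : (fun h => phi (h + y) - phi y) @ (0 : 'rV[R]_n) --> (0 : 'rV[R]_n).
  apply/(@cvgrPdist_le _ _ _ (nbhs (0 : 'rV[R]_n))) => t t0.
  have t1 : 0 < l'^-1 * t by rewrite mulr_gt0// invr_gt0.
  have near1 : \forall h \near (0 : 'rV[R]_n), `|h| <= l'^-1 * t.
    exact: nbhs0_le.
  have : \forall h \near (0 : 'rV[R]_n), `|0 - (phi (h + y) - phi y)| <= t.
    apply: filterS (filterI near0 near1) => h [Eh ht].
    by rewrite sub0r normrN (le_trans (lip' _ Eh))// addrK -ler_pdivlMl.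
  by [].
have near2 := cphi _ (diffE_near dG d0).
apply: filterS (filterI near0 near2) => h [Eh hG].
set dx := phi (h + y) - phi y in hG *.
have {}hG : `|G (dx + phi y) - G (phi y) - 'd G (phi y) dx|
    <= e / (b * l') * `|dx| by exact: hG.
rewrite subrK !Gphi// addrK in hG.
have -> : dx - mulmxr (invmx M) h = - mulmxr (invmx M) (h - 'd G (phi y) dx).
  by rewrite linearB /= diffE_jacobian mulmxK// opprB.
rewrite normrN (le_trans (Mb _))//.
rewrite -ler_pdivlMl// (le_trans hG)//.
rewrite invfM -!mulrA mulrCA ler_wpM2l ?invr_ge0 ?(ltW b0)//.
rewrite ler_wpM2l ?(ltW e0)// ler_pdivrMl//.
by have := lip' _ Eh; rewrite addrK.
Qed.

(** Smoothness is bootstrapped: ['d phi y] is the inverse of the Jacobian of [G]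
    at [phi y], so if [phi] is [C^j] and [G] is [C^j.+1], then the entries of
    this matrix are [C^j] in [y], and [phi] is [C^j.+1]. The neighbourhood [E] is
    chosen before the degree, as the case of infinite smoothness requires. *)
Theorem inverse_function n (D : set 'rV[R]_n) (G : 'rV[R]_n -> 'rV[R]_n)
    (a : 'rV[R]_n) :
  open D -> D a -> Cfin_open 1 D G -> (forall v, 'd G a v = 0 -> v = 0) ->
  exists (E : set 'rV[R]_n) (phi : 'rV[R]_n -> 'rV[R]_n),
    [/\ open E /\ E (G a), phi (G a) = a,
        forall y, E y -> D (phi y) /\ G (phi y) = y &
        forall k, C_open k D G -> C_open k E phi].
Proof.
move=> oD Da cG inj.
have [E [phi [l [[oE Ea] phia phiP lip]]]] := local_inverse oD Da cG inj.
exists E, phi; split=> // [y /phiP[]//|].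
have dphi y : E y -> is_diff y phi (fun v => v *m invmx ('J G (phi y))).
  move=> Ey; have [Dy Gy uJ] := phiP y Ey.
  apply: (is_diff_inverse (l := l) oE Ey) => // [|z /phiP[]//|z Ez].
    exact: cG.1.
  exact: lip.
have smooth j : Cfin_open j D G -> Cfin_open j E phi; last first.
  by case=> [j|] ckG => [|j]; apply: smooth => //; exact: ckG.
elim: j => [|j IH] cjG.
  by move=> y Ey; apply: differentiable_continuous; case: (dphi y Ey).
have cphi := IH (Cfin_openW cjG).
apply: (Cfin_openS_intro oE dphi) => v.
apply: Cfin_open_coord => // i.
under eq_fun do rewrite mxE.
apply: Cfin_open_sum => // k.
apply: Cfin_openZ => //; first exact: Cfin_open_cst.
apply: Cfin_open_invmx => // [y /phiP[]//|{}i {}k].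
under eq_fun do rewrite mxE.
apply: (Cfin_open_postlinear (L := coord_lin ord0 k)) => //.
  exact: coord_lin_continuous.
apply: (Cfin_open_comp (rV_frame n) oE (E := D) (F := phi)
   (G := fun x => 'd G x (delta_mx 0 i))) => //; last exact: cjG.2.
by move=> y /phiP[].
Qed.

End InverseFunction.

(** * Exponential stability and linearization *)

Section Stability.
Context {R : realType}.

Lemma exp_decay_small (c lam e : R) : 0 < lam -> 0 < e -> 0 <= c ->
  exists2 T, 0 <= T & c * expR (- (lam * T)) <= e.
Proof.
move=> lam0 e0 c0; exists (c / (e * lam)).
  by rewrite divr_ge0// mulr_ge0// ltW.
rewrite expRN ler_pdivrMr ?expR_gt0//.
have h := expR_ge1Dx (lam * (c / (e * lam))).
apply: le_trans (_ : e * (1 + lam * (c / (e * lam))) <= _); last first.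
  by rewrite ler_wpM2l// ltW.
have -> : lam * (c / (e * lam)) = c / e.
  by rewrite invfM mulrCA [_ * lam^-1]mulrC mulVKf ?gt_eqF.
rewrite mulrDr mulr1 mulrC mulfVK ?gt_eqF// lerDr ltW//.
Qed.

(** If the Jacobian were singular, then [w *m ('J g 0)^T = 0] for some nonzero
    [w], so that [l x := x *m w^T] kills the linear part of [g]. Along the
    solution from [x0 := eps *: w] the derivative of [l] is then [o(|x|)], and
    [|x|] stays below [M * |x0|]: for small [eps], the change of [l] on a fixed
    interval [[0, T]] is small compared with [eps]. But [|l x0| = eps * q] with
    [q > 0], while exponential decay makes [l (x T)] small compared with it. *)
Lemma exp_stable_jacobian_unit n (O : set 'rV[R]_n) (g : 'rV[R]_n -> 'rV[R]_n) :
  nbhs (0 : 'rV[R]_n) O -> differentiable g 0 -> uniqueness_criterion O g ->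
  exp_stable_equilibrium O g -> 'J g 0 \in unitmx.
Proof.
move=> nO dg [_ uc] [g0 [delta [M [lam [delta0 M0 lam0 stab]]]]].
rewrite -unitmx_tr -row_free_unit; apply: inj_row_free => w wJ.
apply/eqP/negPn/negP => w0.
have [b b0 wb] := linear_lipschitz (@linear_rV_continuous R n _ (mulmxr w^T)).
have Lg0 v : 'd g 0 v *m w^T = 0.
  rewrite diffE_jacobian -mulmxA -[X in _ *m X]trmxK trmx_mul !trmxK wJ.
  by rewrite trmx0 mulmx0.
pose q := `|w *m w^T|.
have q0 : 0 < q.
  rewrite normr_gt0; apply: contra w0 => /eqP /matrixP /(_ ord0 ord0).
  rewrite !mxE => /eqP; rewrite psumr_eq0 => [|k _]; last first.
    by rewrite mxE -expr2 sqr_ge0.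
  move=> /allP ww; apply/eqP/rowP => k; have := ww k (mem_index_enum _).
  by rewrite !mxE mulf_eq0 orbb => /eqP.
have p0 : 0 < `|w| by rewrite normr_gt0.
(* At time [T], decay alone has brought [l x] below a quarter of its initial
   size. *)
have [T T0 Tq] : exists2 T, 0 <= T &
    (b * M * `|w|) * expR (- (lam * T)) <= q / 4.
  by apply: exp_decay_small => //; [rewrite divr_gt0|rewrite !mulr_ge0// ltW].
(* [eta] is the relative size of the remainder of [g] for which [l x] changes by
   at most another quarter up to time [T]; [T + 1] avoids dividing by zero. *)
pose eta := q / 4 / (M * `|w| * (T + 1)) / b.
have T1 : 0 < T + 1 by rewrite ltr_wpDl.
have eta0 : 0 < eta by rewrite !divr_gt0// !mulr_gt0.
have [r r0 rP] : exists2 r : R, 0 < r & forall x, `|x| < r ->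
    `|g x *m w^T| <= b * eta * `|x|.
  have /nbhs_ballP[r /= r0 rP] := diffE_near dg eta0.
  exists r => // x xr; have := rP x.
  rewrite -ball_normE /= sub0r normrN => /(_ xr).
  rewrite addr0 g0 subr0 => gx.
  rewrite -[g x *m w^T]subr0 -[X in _ - X](Lg0 x) -mulmxBl.
  by rewrite (le_trans (wb _))// -mulrA ler_wpM2l// ltW.
have /nbhs_ballP[rho /= rho0 rhoP] := uc.
pose eps := Num.min (Num.min rho delta) (r / M) / 2 / `|w|.
have eps0 : 0 < eps by rewrite !divr_gt0// !lt_min rho0 delta0 divr_gt0.
have x0E : `|eps *: w| = eps * `|w| by rewrite normrZ gtr0_norm.
have : eps * `|w| < Num.min (Num.min rho delta) (r / M).
  rewrite /eps divfK ?gt_eqF// ltr_pdivrMr// ltr_pMr ?ltr1n//.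
  by rewrite !lt_min rho0 delta0 divr_gt0.
rewrite !lt_min => /andP[/andP[erho edelta] er].
have [|x [xsol x0 _]] := rhoP (eps *: w).
  by rewrite -ball_normE /= sub0r normrN x0E.
have xstab t : 0 <= t -> `|x t| <= M * expR (- (lam * t)) * (eps * `|w|).
  by rewrite -x0E -x0; apply: stab => //; rewrite x0 x0E.
have xM t : 0 <= t -> `|x t| <= M * (eps * `|w|).
  move=> t0; rewrite (le_trans (xstab t t0))// ler_wpM2r//.
    by rewrite mulr_ge0// ltW.
  by rewrite ler_piMr ?(ltW M0)// -expR0 ler_expR oppr_le0 mulr_ge0// ltW.
have xr t : 0 <= t -> `|x t| < r.
  by move=> /xM /le_lt_trans; apply; rewrite mulrC -ltr_pdivlMr.
have [_ xc xd] := xsol.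
pose y t := x t *m w^T.
have yT : `|y T - y 0| <= b * eta * (M * (eps * `|w|)) * (T - 0).
  apply: (@mean_value_rV _ _ y (fun t => g (x t) *m w^T)) => // [t||t].
  - rewrite in_itv/= => /andP[t0 _].
    apply: (is_derive_linear (L := mulmxr w^T)).
      exact: linear_rV_continuous.
    by apply: xd => //=; rewrite in_itv/= andbT ltW.
  - apply: (@within_continuous_comp _ _ _ _ x (mulmxr w^T)) => /=.
      move=> v _; exact: (@linear_rV_continuous R n _ (mulmxr w^T)).
    apply: continuous_subspaceW xc => t /=.
    by rewrite !in_itv/= => /andP[-> _].
  - rewrite in_itv/= => /andP[/ltW t0 _].
    rewrite (le_trans (rP _ (xr t t0)))// ler_wpM2l ?xM//.
    by rewrite mulr_ge0// ltW.
have y0 : `|y 0| = eps * q.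
  by rewrite /y x0 -scalemxAl normrZ gtr0_norm.
have yTs : `|y T| <= eps * (q / 4).
  rewrite (le_trans (wb _))//.
  rewrite (le_trans (ler_wpM2l (ltW b0) (xstab T T0)))//.
  have := ler_wpM2l (ltW eps0) Tq; congr (_ <= _).
  by set a := expR _; ring.
have small : b * eta * (M * (eps * `|w|)) * (T - 0) <= eps * (q / 4).
  have -> : b * eta * (M * (eps * `|w|)) * (T - 0) =
      eps * (q / 4) * (T / (T + 1)).
    by rewrite /eta; field; rewrite !gt_eqF.
  have TT : T / (T + 1) <= 1 by rewrite ler_pdivrMr// mul1r lerDl.
  by rewrite ler_piMr// ltW// mulr_gt0// divr_gt0.
have := ler_normB (y T) (y T - y 0).
rewrite subKr y0 => h.
have : eps * q <= eps * (q / 4) + eps * (q / 4).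
  by rewrite (le_trans h)// lerD// (le_trans yT).
rewrite -mulrDr ler_pM2l//.
by lra.
Qed.

End Stability.

Lemma is_derive_exp_decay (R : realType) (V : normedModType R) (v : V) (t : R) :
  is_derive t (1 : R) (fun s => expR (- s) *: v) (- (expR (- t) *: v)).
Proof.
have /is_derive_is_diff de :
    is_derive t (1 : R) (fun s => expR (- s)) (- expR (- t)).
  have dN : is_derive t (1 : R) (fun s : R => - s) (- 1).
    exact: is_deriveNid.
  have := is_derive1_comp (is_derive_expR (- t)) dN.
  by rewrite mulrN1.
apply/is_derive_is_diff; have := is_diff_scale de (is_diff_cst v t).
congr (is_diff _ _ _); apply/funext => s.
by rewrite scaler0 add0r -scaleNr scalerA.
Qed.

(** [expR t *: y t] has derivative zero. *)
Lemma solution_decay (R : realType) n (O : set 'rV[R]_n)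
    (g : 'rV[R]_n -> 'rV[R]_n) (J : set R) (y : R -> 'rV[R]_n) (T : R) :
  (forall x, O x -> g x = - x) -> is_solution O g J y -> 0 <= T ->
  `[0, T] `<=` J -> y T = expR (- T) *: y 0.
Proof.
move=> gN [yO yc yd] T0 TJ.
pose z t := expR t *: y t.
have : `|z T - z 0| <= 0 * (T - 0).
  apply: (@mean_value_rV _ _ z (fun=> 0)) => // [t tT||t _].
  - have [t0 t1] : 0 < t /\ t <= T.
      by move: tT; rewrite in_itv/= => /andP[? /ltW].
    have Jt : J t by apply: TJ; rewrite /= in_itv/= (ltW t0).
    have /is_derive_is_diff dy := yd t Jt t0.
    have /is_derive_is_diff de := is_derive_expR t.
    apply/is_derive_is_diff; have := is_diff_scale de dy.
    congr (is_diff _ _ _); apply/funext => s.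
    rewrite gN; last exact: yO.
    rewrite scaler0 !scalerN !scalerA -[s *: expR t]/(s * expR t).
    by rewrite [s * _]mulrC addNr.
  - move=> t; apply: cvgZ.
      exact/continuous_subspaceT/continuous_expR.
    exact: (continuous_subspaceW TJ yc).
  - by rewrite normr0.
rewrite mul0r normr_le0 subr_eq0 /z expR0 scale1r => /eqP <-.
by rewrite scalerA -expRD addNr expR0 scale1r.
Qed.

(** * Sections and stabilizing symbols *)

(** The closed loop field [G] is a [C^k] map with [G 0 = 0] and invertible
    Jacobian at the origin; if [phi] is its local inverse, then
    [f (h (phi y)) = y], so that [h \o phi] is a section. *)
Lemma section_of_stabilizer (R : realType) (n m : nat) (k : smoothness)
    (X : set 'rV[R]_n) (U : set 'rV[R]_m)
    (f : 'rV[R]_n * 'rV[R]_m -> 'rV[R]_n) :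
  at_least_C1 k -> C_on k (X `*` U) f -> f (0, 0) = 0 ->
  exp_stabilizable_C_stationary k X U f -> has_C_stationary_section k X U f.
Proof.
move=> hk [D [F [oD XUD Ff CF]]] f0.
move=> [ O [h [ [nO OX hXU uc es] [D' [H [oD' OD' Hh CH]]] h0]]].
pose O1 := O^°.
have oO1 : open O1 by exact: open_interior.
have O1O : O1 `<=` O by exact: interior_subset.
have O10 : O1 0 by exact: nO.
have HXU x : O1 x -> (X `*` U) (H x).
  by move=> /O1O Ox; rewrite Hh//; exact: hXU.
pose G := F \o H.
have Gg x : O1 x -> G x = comp_op h f x.
  by move=> /O1O Ox; rewrite /G /comp_op /= Hh// Ff//; exact: hXU.
have CH1 : C_open k O1 H by apply: C_open_sub CH => x /O1O/OD'.
have [c [e ce]] := @pair_frame R n m.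
have CG : C_open k O1 G.
  by apply: (C_open_comp ce oO1 (E := D)) => // x /HXU/XUD.
have C1G := C_open_C1 hk CG.
have Gg0 : \forall x \near (0 : 'rV[R]_n), G x = comp_op h f x.
  by apply: filterS (open_nbhs_nbhs (conj oO1 O10)) => x /Gg.
have [dg _] := near_eq_diff Gg0 (C1G.1 0 O10).
have uJ := exp_stable_jacobian_unit nO dg uc es.
have G0 : G 0 = 0 by rewrite Gg// /comp_op /= h0.
have inj v : 'd G 0 v = 0 -> v = 0.
  have [_ ->] := near_eq_diff Gg0 (C1G.1 0 O10); rewrite diffE_jacobian.
  move=> /(congr1 (mulmxr (invmx ('J (comp_op h f) 0)))) /=.
  by rewrite (mulmxK uJ) mul0mx; apply.
have [E [phi [ [oE E0] phi0 phiP phiC]]] := inverse_function oO1 O10 C1G inj.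
rewrite G0 in E0 phi0.
have CHphi : C_open k E (H \o phi).
  apply: (C_open_comp (rV_frame n) oE (E := O1)) _ (phiC _ CG) CH1.
  by move=> y /phiP[].
exists E, (H \o phi); split; last 2 first.
- exact/C_on_open.
- rewrite /stationary /= phi0 (Hh _ (nbhs_singleton nO)); exact: h0.
split; first by [].
- apply: continuous_in_subspaceT => y; rewrite inE => Ey.
  exact: (Cfin_open_continuous (C_open_C1 hk CHphi)).
- by move=> y /phiP[/HXU].
- by move=> y /phiP[Ophi Gy]; rewrite -[RHS]Gy; exact/esym/Ff/HXU.
Qed.

(** For a section [alpha], the symbol [x |-> alpha (- x)] turns the system into
    [x' = - x]. *)
Lemma stabilizer_of_section (R : realType) (n m : nat) (k : smoothness)
    (X : set 'rV[R]_n) (U : set 'rV[R]_m)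
    (f : 'rV[R]_n * 'rV[R]_m -> 'rV[R]_n) :
  nbhs (0 : 'rV[R]_n) X ->
  has_C_stationary_section k X U f -> exp_stabilizable_C_stationary k X U f.
Proof.
move=> hX [E [alpha [ [[oE E0] _ aXU falpha] Ca a0]]].
have /nbhs_ballP[r /= r0 rP] : nbhs (0 : 'rV[R]_n) (X `&` E).
  by apply: filterI => //; exact: open_nbhs_nbhs.
pose O := ball (0 : 'rV[R]_n) r.
have ON x : O x -> O (- x) by rewrite /O -ball_normE /= !sub0r !normrN.
have OE x : O x -> E (- x) by move=> /ON/rP[].
pose h x := alpha (- x).
have gN x : O x -> comp_op h f x = - x by move=> /OE/falpha.
have O0 : O 0 by exact: ballxx.
have oO : open O by exact: ball_open.
have cN j : Cfin_open j O (fun x : 'rV[R]_n => - x).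
  apply: (@Cfin_open_linear R _ _ j O -%R) => //; exact: linear_rV_continuous.
exists O, h; split; last by rewrite /stationary /h oppr0.
  split.
  - exact: nbhsx_ballx.
  - by move=> x /rP[].
  - by move=> x /OE/aXU.
  - split.
      apply: continuous_in_subspaceT => x; rewrite inE => Ox.
      by apply: (Cfin_open_ext (j := 0) oO _ (cN 0)) => // y /gN.
    near=> x0; have Ox0 : O x0 by near: x0; exact: nbhsx_ballx.
    exists (fun t => expR (- t) *: x0).
    have dx (t : R) : is_derive t (1 : R) (fun t => expR (- t) *: x0)
        (- (expR (- t) *: x0)) by exact: is_derive_exp_decay.
    have xO t : 0 <= t -> O (expR (- t) *: x0).
      move=> t0; move: Ox0; rewrite /O -ball_normE /= !sub0r !normrN.
      apply: le_lt_trans; rewrite normrZ ger0_norm ?expR_ge0//.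
      by rewrite ler_piMl// -expR0 ler_expR oppr_le0.
    split.
    + split.
      * by move=> t /=; rewrite in_itv/= andbT; exact: xO.
      * by apply: derivable_within_continuous => t _; case: (dx t).
      * by move=> t _ /ltW/xO/gN ->; exact: dx.
    + by rewrite oppr0 expR0 scale1r.
    + move=> T y T0 ysol y0 t /andP[t0 tT]; rewrite -y0.
      apply: (solution_decay gN ysol t0) => s.
      by rewrite /= !in_itv/= => /andP[->] /le_lt_trans; exact.
  - split; first by rewrite gN// oppr0.
    exists 1, 1, 1; split => // x xsol _ t t0; rewrite !mul1r.
    rewrite (solution_decay gN xsol t0).
      by rewrite normrZ ger0_norm ?expR_ge0.
    by move=> s; rewrite /= !in_itv/= andbT => /andP[].
apply/C_on_open => //; apply: (C_open_comp (rV_frame n) oO (E := E)) => //.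
  by case: (k) => [j|j]; exact: cN.
exact/C_on_open.
Unshelve. all: by end_near. Qed.

Theorem theorem3p2 (R : realType) (n m : nat) (k : smoothness)
    (X : set 'rV[R]_n) (U : set 'rV[R]_m)
    (f : 'rV[R]_n * 'rV[R]_m -> 'rV[R]_n)
    (hk : at_least_C1 k)
    (hX : nbhs (0 : 'rV[R]_n) X) (hU : nbhs (0 : 'rV[R]_m) U)
    (hf : C_on k (X `*` U) f) (hf0 : f (0, 0) = 0) :
  exp_stabilizable_C_stationary k X U f <-> has_C_stationary_section k X U f.
Proof.
split; first exact: section_of_stabilizer.
exact: stabilizer_of_section.
Qed.
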